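(* Let $A = x^a(x+1)^b(x+\alpha)^c(x+\alpha+1)^d \in \mathbb{F}_4[x]$ with $a,b,c,d\in\mathbb{N}$, and suppose that $A$ is bi-unitary perfect. Let $\mathcal{T}=\{r\in\mathbb{N}^* : r=2 \text{ or } r=2^n-1 \text{ for some } n\in\mathbb{N}^*\}$ and $\Sigma=\{(x^2+x)^r,\ (x^2+x+1)^r : r\in\mathcal{T}\}$. Then: i) if $\omega(A)=2$, then $A\in\Sigma$; ii) if $A$ is trivially bi-unitary perfect and $\omega(A)\ge 3$, then $A=A_1A_2$ for some $A_1,A_2\in\Sigma$.
   Context: $\mathbb{N}$ is the set of non-negative integers, $\mathbb{N}^*$ the set of positive integers. $\mathbb{F}_4=\{0,1,\alpha,\alpha+1\}$ is the field with 4 elements, with $\alpha^2+\alpha+1=0$. All divisors of polynomials are taken monic. For a monic polynomial $S$ over a finite field, a divisor $D$ of $S$ is unitary if $\gcd(D,S/D)=1$; $\gcd_u(S,T)$ denotes the greatest common unitary divisor of $S$ and $T$; a divisor $D$ of $S$ is bi-unitary if $\gcd_u(D,S/D)=1$. $\sigma^{**}(S)$ is the sum of all bi-unitary divisors of $S$, and $S$ is bi-unitary perfect if $\sigma^{**}(S)=S$. $\omega(S)$ is the number of distinct (monic) irreducible factors of $S$. A polynomial $A$ is trivially bi-unitary perfect if it is bi-unitary perfect and can be written $A=A_0\cdots A_r$ with $r\ge 1$, each $A_i$ nonconstant and bi-unitary perfect (over the same field), and $\gcd(A_i,A_j)=1$ for $i\ne j$. *)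

(* Defs.v *)
From mathcomp Require Import all_boot all_order all_algebra all_field.

Set Implicit Arguments.
Unset Strict Implicit.
Unset Printing Implicit Defensive.

Import GRing.Theory.
Local Open Scope ring_scope.

Section BiUnitary.
Variable F : finFieldType.
Implicit Types A D S T : {poly F}.

(* The divisors of a nonzero S all have size at most [size S], so they are
   enumerated through the finite type of polynomials of bounded size. *)
Definition monic_divisors S : seq {poly F} :=
  [seq D <- [seq val p | p : {poly_(size S) F}] | (D \is monic) && (D %| S)].

Definition unitary_divisor S D : bool :=
  (D \in monic_divisors S) && coprimep D (S %/ D).

Lemma mem_monic_divisors S D : S != 0 ->
  (D \in monic_divisors S) = (D \is monic) && (D %| S).
Proof.
move=> S0; rewrite mem_filter; apply: andb_idr => /andP[_ DS]; apply/imageP.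
by exists (NPoly (dvdp_leq S0 DS : D \is a poly_of_size _)).
Qed.

Lemma uniq_monic_divisors S : uniq (monic_divisors S).
Proof. by rewrite filter_uniq // map_inj_uniq ?enum_uniq //; apply: val_inj. Qed.

(* The common unitary divisor of largest degree, which is unique when S and T
   are monic; 1 is then one of the candidates. *)
Definition gcdu S T : {poly F} :=
  foldr (fun D G : {poly F} => if (size G < size D)%N then D else G) 1
    [seq D <- monic_divisors S | unitary_divisor S D && unitary_divisor T D].

Lemma gcdu_greatest S T : S \is monic -> T \is monic ->
  [/\ unitary_divisor S (gcdu S T), unitary_divisor T (gcdu S T)
    & forall D, unitary_divisor S D -> unitary_divisor T D ->
        (size D <= size (gcdu S T))%N].
Proof.
move=> mS mT; rewrite /gcdu.
have u1 U : U \is monic -> unitary_divisor U 1.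
  by move=> mU; rewrite /unitary_divisor mem_monic_divisors ?monic_neq0 //
    monic1 dvd1p coprime1p.
set s := [seq _ <- _ | _]; set G := foldr _ _ _.
have [uG mG] : unitary_divisor S G && unitary_divisor T G
    /\ forall D, D \in s -> (size D <= size G)%N.
  have: all (fun D => unitary_divisor S D && unitary_divisor T D) s.
    exact: filter_all.
  rewrite {}/G; elim: (s) => [_|E r IH /= /andP[uE /IH[uG mG]]] /=.
    by rewrite !u1.
  case: ltnP => h; split=> // D; rewrite inE => /orP[/eqP->//|/mG] //.
  by move=> /leq_trans; apply; apply: ltnW.
have /andP[-> ->] := uG; split=> // D uS uT; apply: mG.
by rewrite mem_filter uS uT; case/andP: uS.
Qed.

Definition biunitary_divisor S D : bool :=
  (D \in monic_divisors S) && (gcdu D (S %/ D) == 1).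

Definition sigma_bu S : {poly F} :=
  \sum_(D <- monic_divisors S | biunitary_divisor S D) D.

Definition biunitary_perfect S : Prop := S \is monic /\ sigma_bu S = S.

Definition omega S : nat :=
  size [seq P <- monic_divisors S | irreducibleb P].

Definition trivially_biunitary_perfect A : Prop :=
  biunitary_perfect A /\
  exists (r : nat) (B : 'I_r.+1 -> {poly F}),
    [/\ (1 <= r)%N,
        A = \prod_(i < r.+1) B i,
        forall i, (1 < size (B i))%N /\ biunitary_perfect (B i)
      & forall i j, i != j -> coprimep (B i) (B j)].

End BiUnitary.

Definition calT (r : nat) : Prop :=
  (0 < r)%N /\ (r = 2%N \/ exists n : nat, (0 < n)%N /\ r = (2 ^ n - 1)%N).

Definition Sigma (F : finFieldType) (A : {poly F}) : Prop :=
  exists r : nat, calT r /\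
    (A = ('X^2 + 'X) ^+ r \/ A = ('X^2 + 'X + 1) ^+ r).

(* Main.v *)
(* Over a finite field, the monic divisors of a product of linear factors
   correspond to exponent functions, and sigma** becomes the product over the
   roots x of local factors sigma**((X - x)^k), k the multiplicity of x. A local
   factor is coprime to X - x, so if A is perfect with two roots x, y then
   sigma**((X - x)^k) = (X - y)^k, and the two multiplicities agree. In
   characteristic 2, evaluating at X - x = 1 gives y = x + 1; comparing the
   linear coefficients when k is even gives k = 2, and when k is odd the
   identity (T - 1)^(k+1) = T^(k+1) - 1 forces k + 1 to be a power of 2.
   Finally a nonconstant perfect product has at least two roots, so with four
   elements in the field a trivial factorization has exactly two factors, each
   with two roots. *)
Require Import Defs.
From mathcomp Require Import all_boot all_order all_algebra all_field.
From mathcomp Require Import ring.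

Set Implicit Arguments.
Unset Strict Implicit.
Unset Printing Implicit Defensive.

Import GRing.Theory.
Local Open Scope ring_scope.

(** * Products of linear factors, encoded by their exponent functions *)

Section SplitPoly.
Variable F : finFieldType.
Implicit Types (e f g h : F -> nat) (x y : F) (D E : {poly F}).

Definition split_poly e : {poly F} := \prod_x ('X - x%:P) ^+ e x.

Lemma monic_split e : split_poly e \is monic.
Proof. by apply: monic_prod => x _; rewrite monic_exp ?monicXsubC. Qed.

Lemma split_neq0 e : split_poly e != 0.
Proof. exact/monic_neq0/monic_split. Qed.

Lemma eq_split e f : e =1 f -> split_poly e = split_poly f.
Proof. by move=> ef; apply: eq_bigr => x _; rewrite ef. Qed.

Lemma splitD e f : split_poly (fun x => e x + f x)%N = split_poly e * split_poly f.
Proof. by rewrite -big_split; apply: eq_bigr => x _; rewrite exprD. Qed.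

Lemma split_XsubCX x n :
  ('X - x%:P) ^+ n = split_poly (fun y => if y == x then n else 0%N).
Proof.
rewrite /split_poly (bigD1 x) //= eqxx big1 ?mulr1 // => y /negbTE->.
by rewrite expr0.
Qed.

Lemma split_seq (s : seq F) :
  \prod_(x <- s) ('X - x%:P) = split_poly (fun x => count_mem x s).
Proof.
rewrite -prodr_undup_exp_count big_uniq ?undup_uniq //= /split_poly.
rewrite [RHS](bigID (mem (undup s))) /= [X in _ * X]big1 ?mulr1 // => x.
by rewrite mem_undup => /count_memPn ->; rewrite expr0.
Qed.

(** Listing every root with repetition makes the results on products of ['X - x%:P] over a sequence
    applicable, both for multiplicities and for divisors. *)
Lemma splitE e : split_poly e =
  \prod_(x <- flatten [seq nseq (e y) y | y <- enum F]) ('X - x%:P).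
Proof.
rewrite big_flatten big_map big_enum; apply: eq_bigr => x _.
by rewrite big_nseq -Monoid.iteropE.
Qed.

Lemma mup_split e x : mup x (split_poly e) = e x.
Proof.
rewrite splitE mu_prod_XsubC count_flatten -map_comp sumnE big_map big_enum /=.
rewrite (bigD1 x) //= count_nseq /= eqxx mul1n big1 ?addn0 // => y yx.
by rewrite count_nseq /= (negbTE yx).
Qed.

Lemma split_inj e f : split_poly e = split_poly f -> e =1 f.
Proof. by move=> ef x; rewrite -(mup_split e) ef mup_split. Qed.

(** By unique factorization a monic divisor is the product over a subsequence of the listed roots,
    so its multiplicities determine it. *)
Lemma split_divisor e D : D \in monic_divisors (split_poly e) ->
  D = split_poly (fun x => mup x D).
Proof.
rewrite mem_monic_divisors ?split_neq0 // => /andP[mD];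
  rewrite splitE => /dvdp_prod_XsubC[m].
rewrite eqp_monic ?monic_prod_XsubC // => /eqP ->.
by rewrite [LHS]split_seq; apply: eq_split => x; rewrite mu_prod_XsubC.
Qed.

Lemma split_factor f e : (forall x, f x <= e x)%N ->
  split_poly e = split_poly (fun x => e x - f x)%N * split_poly f.
Proof. by move=> fe; rewrite -splitD; apply: eq_split => x; rewrite subnK. Qed.

Lemma dvdp_split f e : (split_poly f %| split_poly e) = [forall x, f x <= e x]%N.
Proof.
apply/idP/forallP => [fe x | fe].
  rewrite -(mup_split e) mup_geq ?split_neq0 //; apply: dvdp_trans fe.
  by rewrite -mup_geq ?split_neq0 // mup_split.
by rewrite (split_factor fe) dvdp_mull.
Qed.

Lemma divp_split f e : (forall x, f x <= e x)%N ->
  split_poly e %/ split_poly f = split_poly (fun x => e x - f x)%N.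
Proof.
by move=> fe; rewrite (split_factor fe) mulpK ?split_neq0.
Qed.

Lemma coprimep_split f g :
  coprimep (split_poly f) (split_poly g) = [forall x, (f x == 0) || (g x == 0)]%N.
Proof.
apply/idP/forallP => [cfg x | fg].
  rewrite !eqn0Ngt -negb_and -{1}(mup_split f x) -(mup_split g x).
  rewrite -!XsubC_dvd ?split_neq0 //; apply/negP => /andP[xf xg].
  have := coprimep_dvdl xg (coprimep_dvdr xf cfg).
  by rewrite coprimep_XsubC root_XsubC eqxx.
apply: (big_rec (fun D => coprimep D _)) => [|x D _ cD]; first exact: coprime1p.
rewrite coprimepMl cD andbT.
apply: (big_rec (coprimep _)) => [|y E _ cE]; first exact: coprimep1.
rewrite coprimepMr cE andbT.
have [->|xy] := eqVneq x y.
  by have /orP[] := fg y => /eqP ->; rewrite ?coprime1p ?coprimep1.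
by apply/coprimep_expl/coprimep_expr/coprimep_XsubC2; rewrite subr_eq0 eq_sym.
Qed.

(** * Bi-unitary divisors, [sigma_bu] and [omega] in terms of exponents *)

Lemma unitary_split e h : unitary_divisor (split_poly e) (split_poly h) =
  [forall x, (h x == 0) || (h x == e x)]%N.
Proof.
rewrite /unitary_divisor mem_monic_divisors ?split_neq0 // monic_split /=.
rewrite dvdp_split; apply/andP/forallP => [[/forallP he] | he].
  rewrite divp_split // coprimep_split => /forallP + x => /(_ x).
  by rewrite subn_eq0 [h x == e x]eqn_leq he.
have le_he x : (h x <= e x)%N by have /orP[/eqP->|/eqP->] := he x.
split; first exact/forallP.
rewrite divp_split // coprimep_split; apply/forallP => x.
by rewrite subn_eq0; have /orP[->//|/eqP->] := he x; rewrite leqnn orbT.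
Qed.

Lemma gcdu_split_eq1 f g : (gcdu (split_poly f) (split_poly g) == 1) =
  [forall x, (f x == g x) ==> (f x == 0)]%N.
Proof.
have [uGf uGg Gmax] := gcdu_greatest (monic_split f) (monic_split g).
set G := gcdu _ _ in uGf uGg Gmax *.
apply/eqP/forallP => [G1 x | fg].
  (* When [f x = g x], the full power of ['X - x%:P] is a common unitary divisor, so its degree
     [f x] must be 0. *)
  apply/implyP => /eqP fgx; pose h y := if y == x then f x else 0%N.
  have := Gmax (split_poly h); rewrite G1 size_poly1 !unitary_split -split_XsubCX size_exp_XsubC.
  by rewrite ltnS leqn0; apply; apply/forallP => y; rewrite /h;
    case: (y =P x) => // ->; rewrite ?fgx eqxx orbT.
have GE : G = split_poly (fun x => mup x G).
  by apply: (@split_divisor f); case/andP: uGf.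
rewrite GE unitary_split in uGf; rewrite GE unitary_split in uGg.
rewrite GE /split_poly big1 // => x _.
have /orP[/eqP-> // | /eqP Gf] := forallP uGf x.
have /orP[/eqP-> // | /eqP Gg] := forallP uGg x.
by move: (fg x); rewrite -Gf -Gg eqxx => /eqP ->.
Qed.

(** The cofactor has exponents [e x - f x]. A common unitary factor at [x] requires
    [f x = e x - f x > 0], that is, twice [f x] equal to [e x]. *)
Lemma biunitary_split e f : biunitary_divisor (split_poly e) (split_poly f) =
  [forall x, (f x <= e x) && ((f x == 0) || ((f x).*2 != e x))]%N.
Proof.
rewrite /biunitary_divisor mem_monic_divisors ?split_neq0 // monic_split /=.
rewrite dvdp_split; apply/andP/forallP => [[/forallP fe] | fe].
  rewrite divp_split // gcdu_split_eq1 => /forallP + x => /(_ x).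
  by rewrite fe /= -(eqn_add2r (f x)) subnK // addnn implybE orbC.
have le_fe x : (f x <= e x)%N by have /andP[] := fe x.
split; first exact/forallP.
rewrite divp_split // gcdu_split_eq1; apply/forallP => x.
by rewrite -(eqn_add2r (f x)) subnK // addnn implybE orbC; have /andP[] := fe x.
Qed.

(** For [P] irreducible this is the sum of the bi-unitary divisors of [P ^+ k]: the middle exponent
    is dropped for even [k > 0]. The clause on [i == 0] keeps the divisor 1 when [k = 0]. *)
Definition local_sigma (k : nat) (P : {poly F}) : {poly F} :=
  \sum_(i < k.+1 | (i == 0 :> nat) || (i.*2 != k)) P ^+ i.

Lemma sigma_split e :
  sigma_bu (split_poly e) = \prod_x local_sigma (e x) ('X - x%:P).
Proof.
(* A uniform bound turns exponent functions into a finite function type, over which the product of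
   sums is expanded by distributivity. *)
pose N := \max_x e x.
have eN x : (e x <= N)%N by apply: leq_bigmax.
pose Q x (i : 'I_N.+1) := (i <= e x)%N && ((i == 0 :> nat) || (i.*2 != e x)).
transitivity (\prod_x \sum_(i < N.+1 | Q x i) ('X - x%:P) ^+ i); last first.
  apply: eq_bigr => x _; rewrite /local_sigma.
  rewrite (big_ord_widen_cond N.+1 (fun i => (i == 0%N) || (i.*2 != e x))
    (fun i => ('X - x%:P) ^+ i)) ?ltnS ?eN //.
  by apply: eq_bigl => i; rewrite /Q ltnS andbC.
rewrite bigA_distr_big_dep.
pose split_ffun (f : {ffun F -> 'I_N.+1}) := split_poly (fun x => f x).
transitivity (\sum_(D <- image split_ffun (family Q)) D); last first.
  by rewrite big_image.
rewrite /sigma_bu -big_filter; apply/perm_big/uniq_perm => [||D].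
- exact/filter_uniq/uniq_monic_divisors.
- rewrite map_inj_uniq ?enum_uniq //.
  by move=> f g /split_inj fg; apply/ffunP => x; apply/val_inj/fg.
rewrite mem_filter; apply/idP/imageP => [|[f Qf ->]].
  case/andP => bD _; have DE : D = split_poly (fun x => mup x D).
    by apply: (@split_divisor e); case/andP: bD.
  rewrite DE biunitary_split in bD; have {}bD := forallP bD.
  pose f := [ffun x => inord (mup x D) : 'I_N.+1].
  have fE x : f x = mup x D :> nat.
    by rewrite ffunE inordK // ltnS (leq_trans _ (eN x)) //; case/andP: (bD x).
  exists f; last by rewrite [LHS]DE; apply: eq_split => x; rewrite fE.
  by apply/familyP => x; rewrite /Q unfold_in /= fE.
have bf : biunitary_divisor (split_poly e) (split_poly (fun x => f x : nat)).
  by rewrite biunitary_split; apply/forallP => x; exact: (familyP Qf).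
by rewrite bf; case/andP: bf.
Qed.

Definition split_supp e : pred F := [pred x | 0 < e x]%N.

Lemma omega_split e : omega (split_poly e) = #|split_supp e|.
Proof.
rewrite /omega cardE -(size_map (fun x : F => 'X - x%:P)); apply/perm_size/uniq_perm.
- exact/filter_uniq/uniq_monic_divisors.
- by rewrite map_inj_uniq ?enum_uniq // => x y /addrI/oppr_inj/polyC_inj.
move=> D; rewrite mem_filter mem_monic_divisors ?split_neq0 //.
apply/andP/mapP => [[/irreducibleP[D1 iD] De] | [x]]; last first.
  rewrite mem_enum => ex ->; rewrite monicXsubC XsubC_dvd ?split_neq0 // mup_split.
  by split=> //; apply/irreducibleP/irredp_XsubC.
have mD : D \is monic by case/andP: De.
have DE : D = split_poly (fun x => mup x D).
  by apply: (@split_divisor e); rewrite mem_monic_divisors ?split_neq0.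
(* A nonconstant [D] has a root [x]; irreducibility then identifies [D] with ['X - x%:P]. *)
have [x Dx] : exists x, (0 < mup x D)%N.
  apply/existsP; apply: contraTT D1 => /existsPn D0.
  rewrite DE /split_poly big1 ?size_poly1 // => x _.
  by rewrite (eqP (_ : mup x D == 0)%N) // eqn0Ngt.
have xD : 'X - x%:P = D.
  apply/eqP; rewrite -eqp_monic ?monicXsubC // iD ?size_XsubC //.
  by rewrite XsubC_dvd ?monic_neq0.
exists x => //; rewrite mem_enum inE -(mup_split e) -XsubC_dvd ?split_neq0 //.
by rewrite xD; case/andP: De.
Qed.

(** * Coefficients and degree of the local factors *)

Lemma local_sigmaX k : local_sigma k 'X =
  \poly_(i < k.+1) ((i == 0)%N || (i.*2 != k))%:R.
Proof.
rewrite /local_sigma poly_def [RHS](bigID (fun i : 'I__ => (i == 0 :> nat) || (i.*2 != k))) /=.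
rewrite [X in _ + X]big1 ?addr0 => [|i /negbTE->]; last by rewrite scale0r.
by apply: eq_bigr => i ->; rewrite scale1r.
Qed.

Lemma coef_local_sigma k i :
  (local_sigma k 'X)`_i = ((i <= k) && ((i == 0) || (i.*2 != k)))%N%:R.
Proof. by rewrite local_sigmaX coef_poly ltnS; case: leqP. Qed.

Lemma local_sigma_top k : (local_sigma k 'X)`_k = 1.
Proof.
rewrite coef_local_sigma leqnn /=; case: k => //= k.
by rewrite -addnn -[X in _ != X]addn0 eqn_add2l.
Qed.

Lemma size_local_sigma k : size (local_sigma k 'X) = k.+1.
Proof.
apply/anti_leq; rewrite {1}local_sigmaX size_poly ltnNge /=.
by apply/negP => /leq_sizeP/(_ k (leqnn k))/eqP; rewrite local_sigma_top oner_eq0.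
Qed.

Lemma local_sigma_comp k D : local_sigma k D = local_sigma k 'X \Po D.
Proof. by rewrite raddf_sum; apply: eq_bigr => i _ /=; rewrite rmorphXn /= comp_polyX. Qed.

Lemma size_local_sigma_XsubC k x : size (local_sigma k ('X - x%:P)) = k.+1.
Proof. by rewrite local_sigma_comp size_comp_poly2 ?size_XsubC ?size_local_sigma. Qed.

Lemma monic_local_sigma k x : local_sigma k ('X - x%:P) \is monic.
Proof.
rewrite local_sigma_comp monicE lead_coef_comp ?size_XsubC // lead_coefXsubC.
by rewrite expr1n mulr1 lead_coefE size_local_sigma local_sigma_top.
Qed.

Lemma coprimep_local_sigma k x n :
  coprimep (local_sigma k ('X - x%:P)) (('X - x%:P) ^+ n).
Proof.
apply: coprimep_expr; rewrite coprimep_XsubC /root local_sigma_comp horner_comp.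
by rewrite hornerXsubC subrr horner_coef0 coef_local_sigma oner_eq0.
Qed.

(** * Constraints that perfection puts on the local factors *)

Lemma perfect_local_sigma_dvd e x : biunitary_perfect (split_poly e) ->
  local_sigma (e x) ('X - x%:P) %| \prod_(y | y != x) ('X - y%:P) ^+ e y.
Proof.
case=> _ perf; rewrite -(Gauss_dvdpr _ (coprimep_local_sigma (e x) x (e x))).
suff: local_sigma (e x) ('X - x%:P) %| split_poly e by rewrite /split_poly (bigD1 x).
by rewrite -perf sigma_split (bigD1 x) //= dvdp_mulr.
Qed.

(** Without another root, the local factor at [x], of degree [e x > 0], would divide 1. *)
Lemma perfect_supp e x : biunitary_perfect (split_poly e) -> (0 < e x)%N ->
  exists2 y, y != x & (0 < e y)%N.
Proof.
move=> perf ex; apply/exists_inP; apply: contraTT ex => /exists_inPn e0.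
have := perfect_local_sigma_dvd x perf.
rewrite big1 => [|y /e0]; last by rewrite -eqn0Ngt => /eqP->.
by rewrite dvdp1 size_local_sigma_XsubC eqSS -eqn0Ngt.
Qed.

(** The local factor at [x] divides [('X - y%:P) ^+ e y], hence is a power of ['X - y%:P]; its
    degree shows that the exponent is [e x]. *)
Lemma perfect_pair e x y : biunitary_perfect (split_poly e) ->
    x != y -> (forall z, z != x -> z != y -> e z = 0)%N ->
  (e x <= e y)%N /\ local_sigma (e x) ('X - x%:P) = ('X - y%:P) ^+ e x.
Proof.
move=> perf xy e0; have := perfect_local_sigma_dvd x perf.
rewrite (bigD1 y) 1?eq_sym //= big1 ?mulr1 => [|z /andP[zx zy]]; last by rewrite e0.
case/dvdp_exp_XsubCP => k ky /[dup] /eqp_size.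
rewrite size_local_sigma_XsubC size_exp_XsubC => -[->].
by rewrite eqp_monic ?monic_local_sigma ?monic_exp ?monicXsubC // => /eqP.
Qed.

(** * Local factors that are powers of a linear polynomial, in characteristic 2 *)

Section Char2.
Hypothesis char2 : 2 \in [pchar F].

(** The value at 1 counts the terms: [k + 1] of them for odd [k], and [k] for even [k]. Both counts
    are even, so 1 is a root. *)
Lemma local_sigma_eq1 k u : (0 < k)%N -> local_sigma k 'X = ('X - u%:P) ^+ k ->
  u = 1.
Proof.
move=> k0 /(congr1 (horner^~ 1)).
rewrite horner_exp hornerXsubC => sE.
suff s1 : (local_sigma k 'X).[1] = 0.
  by move/esym/eqP: sE; rewrite s1 expf_eq0 k0 subr_eq0 /= => /eqP.
have even2 n : ~~ odd n -> n%:R = 0 :> F.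
  by move=> nodd; apply/eqP; rewrite -(dvdn_pcharf char2) dvdn2.
have cE : (local_sigma k 'X).[1] = #|[pred i : 'I_k.+1 | (i == 0 :> nat) || (i.*2 != k)]|%:R.
  rewrite horner_sum -sumr_const; apply: eq_bigr => i _.
  by rewrite hornerXn expr1n.
have [ko|ke] := boolP (odd k).
  rewrite cE (eq_card (B := 'I_k.+1)) ?card_ord ?even2 //= ?ko // => i.
  by rewrite !inE; apply/orP; right; apply: contraL ko => /eqP <-; rewrite odd_double.
have hk : (k./2 < k.+1)%N by rewrite ltnS -{2}(even_halfK ke) -addnn leq_addr.
rewrite cE (eq_card (B := predC1 (Ordinal hk))) => [|i].
  by rewrite cardC1 card_ord even2.
(* The omitted index differs from 0, so the clause [i == 0] does not restore it. *)
have k2 : k./2 != 0%N by case: k k0 ke {cE sE hk i} => [|[|k]].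
have dk j : (j.*2 == k) = (j == k./2).
  by rewrite -[X in _ == X](even_halfK ke) (inj_eq double_inj).
rewrite !inE -val_eqE /= dk orb_idl // => /eqP->.
by rewrite eq_sym.
Qed.

Lemma subX1_exp N : (0 < N)%N -> ('X - 1) ^+ N = 'X^N - 1 :> {poly F} ->
  exists m, N = (2 ^ m)%N.
Proof.
elim/ltn_ind: N => N IH N0 NE.
have [No|Ne] := boolP (odd N).
  case: N No NE {IH N0} => [//|[|N]] No NE; first by exists 0%N.
  (* For odd exponents above 1, the derivatives at 1 give [0 = N.+2] in [F], a contradiction. *)
  have /(congr1 (horner^~ 1)) : (('X - 1) ^+ N.+2)^`() = ('X^(N.+2) - 1)^`() :> {poly F}.
    by rewrite NE.
  rewrite deriv_exp -polyC1 derivXsubC derivB derivXn derivC subr0 mul1r.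
  rewrite !hornerMn horner_exp hornerXn hornerXsubC subrr expr0n expr1n mul0rn.
  by move=> /esym/eqP; rewrite -(dvdn_pcharf char2) dvdn2 No.
have M0 : (0 < N./2)%N by case: N N0 Ne {NE IH} => [|[|N]].
have MN : (N./2 < N)%N by rewrite -{2}(even_halfK Ne) -addnn -addn1 leq_add2l.
have [|m mE] := IH _ MN M0; last by exists m.+1; rewrite -(even_halfK Ne) mE -mul2n expnS.
(* For even [N], both sides are squares. Squaring is injective in characteristic 2, so the identity
   descends to [N./2]. *)
have char2P : 2 \in [pchar {poly F}] by rewrite pchar_poly.
apply/eqP; have: ((('X - 1) ^+ N./2) ^+ 2 == ('X^(N./2) - 1) ^+ 2 :> {poly F}).
  rewrite -exprM muln2 even_halfK // NE sqrrB1 -exprM muln2 even_halfK //.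
  by rewrite mulr2n addrr_pchar2 // subr0 (oppr_pchar2 char2P 1).
by rewrite eqf_sqr (oppr_pchar2 char2P ('X^_ - 1)) orbb.
Qed.

Lemma local_sigma_calT k u : (0 < k)%N -> local_sigma k 'X = ('X - u%:P) ^+ k ->
  u = 1 /\ calT k.
Proof.
move=> k0 sE; have u1 := local_sigma_eq1 k0 sE; split=> //; split=> //.
rewrite {}u1 in sE; have [ko|ke] := boolP (odd k); [right | left].
  have [m mE] : exists m, k.+1 = (2 ^ m)%N.
    (* For odd [k] no exponent is omitted, so the local factor is the full geometric sum and
       multiplying by ['X - 1] gives ['X^k.+1 - 1]. *)
    apply: subX1_exp => //; rewrite exprS -[X in _ * X]sE subrX1; congr (_ * _).
    apply: eq_bigl => i; apply/orP; right.
    by apply: contraL ko => /eqP <-; rewrite odd_double.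
  exists m; rewrite -mE subn1; split=> //.
  by case: m mE => // mE; move: k0; rewrite -ltnS mE.
(* For even [k] the right side has zero derivative, whereas the coefficient of ['X] on the left is 1
   unless [k = 2]. *)
have := congr1 (fun p : {poly F} => p^`().[0]) sE.
have k2 : k%:R = 0 :> F by apply/eqP; rewrite -(dvdn_pcharf char2) dvdn2.
rewrite deriv_exp -mulr_natr -polyC_natr k2 mulr0 horner0 horner_coef0.
rewrite coef_deriv coef_local_sigma k0 /= mulr1n.
by case: eqP => [<- //|_] /eqP; rewrite oner_eq0.
Qed.
End Char2.

(** * Classification over the field with four elements *)

Section Card4.
Hypothesis cardF : #|F| = 4%N.

Lemma char2_card4 : 2 \in [pchar F].
Proof. exact: (@card_finPcharP F 2 2). Qed.

Lemma omega2_Sigma e : biunitary_perfect (split_poly e) ->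
  omega (split_poly e) = 2 -> Sigma (split_poly e).
Proof.
move=> perf; rewrite omega_split => card2e.
have /card_gt0P[x ex] : (0 < #|split_supp e|)%N by rewrite card2e.
have [y yx ey] := perfect_supp perf ex.
have eE : pred2 x y =i split_supp e.
  apply/subset_cardP; first by rewrite card2e card2 eq_sym yx.
  by apply/subsetP => z /pred2P[]->.
have e0 z : z != x -> z != y -> e z = 0%N.
  move=> zx zy; apply/eqP; rewrite eqn0Ngt; have := eE z.
  by rewrite !inE (negbTE zx) (negbTE zy) => <-.
have [lexy sx] : _ /\ _ := perfect_pair perf (contra_neq esym yx) e0.
have [leyx _] := perfect_pair perf yx (fun z zy zx => e0 z zx zy).
have eyx : e y = e x by apply/anti_leq; rewrite lexy leyx.
(* Substituting ['X + x%:P] for ['X] moves the root [x] to 0. *)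
have sX : local_sigma (e x) 'X = ('X - (y - x)%:P) ^+ e x.
  have /(congr1 (comp_poly ('X + x%:P))) := sx.
  rewrite local_sigma_comp -comp_polyA rmorphXn /= !comp_polyB !comp_polyX.
  by rewrite !comp_polyC addrK comp_polyXr polyCB opprB addrA.
have [yxE Tk] := local_sigma_calT char2_card4 ex sX.
exists (e x); split=> //.
have -> : split_poly e = (('X - x%:P) * ('X - y%:P)) ^+ e x.
  rewrite /split_poly (bigD1 x) // (bigD1 y) //= big1 ?mulr1 => [|z /andP[zx zy]].
    by rewrite eyx exprMn.
  by rewrite e0.
have twoF : 2%:R = 0 :> F by apply: pcharf0 char2_card4.
have -> : ('X - x%:P) * ('X - y%:P) = 'X^2 + 'X + (x ^+ 2 + x)%:P :> {poly F}.
  have -> : y = x + 1 by rewrite -yxE addrC subrK.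
  apply/eqP; rewrite -subr_eq0; apply/eqP.
  transitivity (- (2%:R%:P * ('X * (x%:P + 1))) : {poly F}); first by ring.
  by rewrite twoF mul0r oppr0.
(* Since [x ^+ 4 = x], the constant term is idempotent, hence 0 or 1; its value selects one of the
   two families in [Sigma]. *)
have : (x ^+ 2 + x) ^+ 2 == x ^+ 2 + x.
  rewrite -subr_eq0; apply/eqP.
  transitivity (x ^+ 4 - x + 2%:R * x ^+ 3); first by ring.
  by rewrite twoF mul0r addr0 -cardF expf_card subrr.
rewrite -subr_eq0 expr2 -[X in _ - X]mulr1 -mulrBr mulf_eq0 subr_eq0.
by case/orP => /eqP->; [left; rewrite addr0 | right].
Qed.

Lemma trivially_perfect_split e : trivially_biunitary_perfect (split_poly e) ->
  exists A1 A2 : {poly F}, [/\ Sigma A1, Sigma A2 & split_poly e = A1 * A2].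
Proof.
case=> _ [r [B [r1 eB perfB coB]]].
have BE i : B i = split_poly (fun x => mup x (B i)).
  apply: (@split_divisor e); rewrite mem_monic_divisors ?split_neq0 //.
  by rewrite (perfB i).2.1 eB (bigD1 i) ?dvdp_mulr.
pose S i := split_supp (fun x => mup x (B i)).
have S2 i : (2 <= #|S i|)%N.
  have [B1 perf] := perfB i; rewrite BE in B1 perf.
  have /existsP[x ix] : [exists x, S i x].
    apply: contraTT B1 => /existsPn S0; rewrite /split_poly big1 ?size_poly1 // => x _.
    by have := S0 x; rewrite /S /= -eqn0Ngt => /eqP->.
  have [y yx iy] := perfect_supp perf ix.
  by apply/card_gt1P; exists x, y; rewrite eq_sym.
have S_disj i j x : S i x -> S j x -> i = j.
  move=> ix jx; apply/eqP; apply: contraTT ix => /coB.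
  rewrite BE [B j]BE coprimep_split => /forallP/(_ x).
  by rewrite !eqn0Ngt [(0 < mup x (B j))%N]jx orbF.
(* Exchanging the sums counts, for each of the four field elements, the factors vanishing there: at
   most one by coprimality. *)
have sumS : (\sum_i #|S i| <= 4)%N.
  rewrite -cardF -sum1_card.
  under eq_bigr do rewrite -sum1_card big_mkcond.
  rewrite exchange_big leq_sum //= => x _.
  rewrite -big_mkcond sum1_card.
  by apply/card_le1P => i ix j; rewrite inE; apply/idP/eqP => [jx|-> //]; apply: S_disj jx ix.
(* The inequality bounds [r]; once [r = 1], its equality case gives every factor exactly two
   roots. *)
have sum2 : (\sum_(i < r.+1) 2 <= \sum_i #|S i| ?= iff [forall i, 2 == #|S i|])%N.
  by apply: leqif_sum => i _; apply: leqif_eq.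
have r_eq1 : r = 1%N.
  apply/anti_leq; rewrite r1 andbT -ltnS -(leq_pmul2r (isT : 0 < 2)%N).
  by apply: leq_trans sumS; rewrite -[X in (X * _)%N]card_ord -sum_nat_const sum2.
have SigmaB i : Sigma (B i).
  have [_ perf] := perfB i; rewrite BE in perf *; apply: omega2_Sigma => //.
  rewrite omega_split; apply/esym/eqP; move: i {perf}; apply/forallP.
  rewrite -sum2 eqn_leq sum2 sum_nat_const card_ord /=.
  by apply: leq_trans sumS _; rewrite r_eq1.
move: B eB SigmaB {perfB coB BE S S2 S_disj sumS sum2}; rewrite {}r_eq1 => B eB SigmaB.
exists (B ord0), (B (lift ord0 ord0)); split=> //.
by rewrite eB !big_ord_recl big_ord0 mulr1.
Qed.
End Card4.

End SplitPoly.

Theorem proposition3p1 (F : finFieldType) (cardF : #|F| = 4%N)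
  (alpha : F) (halpha : alpha ^+ 2 + alpha + 1 = 0)
  (a b c d : nat) (A : {poly F})
  (defA : A = 'X ^+ a * ('X + 1) ^+ b * ('X + alpha%:P) ^+ c
              * ('X + alpha%:P + 1) ^+ d)
  (perfA : biunitary_perfect A) :
  (omega A = 2%N -> Sigma A) /\
  (trivially_biunitary_perfect A -> (3 <= omega A)%N ->
     exists A1 A2 : {poly F}, [/\ Sigma A1, Sigma A2 & A = A1 * A2]).
Proof.
have [e Ae] : exists e, A = split_poly e.
  have -> : A = ('X - 0%:P) ^+ a * ('X - (- 1)%:P) ^+ b * ('X - (- alpha)%:P) ^+ c
              * ('X - (- (alpha + 1))%:P) ^+ d.
    by rewrite defA !polyCN !opprK polyC0 subr0 polyCD polyC1 addrA.
  (* The witness is the sum of four exponent functions, each concentrated at one root. *)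
  by rewrite !split_XsubCX -!splitD; eexists.
rewrite {}Ae in perfA *; split; first exact: omega2_Sigma.
by move=> triv _; apply: trivially_perfect_split.
Qed.
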